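(* As $x\to\infty$, $$\sum_{r\le x} N_1(0,r)=\frac{3}{\pi^2}\,x\log x+c\,x+O(x^{2/3}),$$ where $c=\frac{3}{\pi^2}\left(3\gamma-1-\frac{2\zeta'(2)}{\zeta(2)}\right)$.
   Context: For $r\in\mathbb{N}=\{1,2,\ldots\}$, $N_1(0,r)$ is the number of solutions $x\in\mathbb{Z}/r\mathbb{Z}$ of $x^2\equiv 0\pmod r$. The sum runs over all positive integers $r\le x$. $\zeta$ is the Riemann zeta function and $\gamma$ is Euler's constant. *)

(* Defs.v *)
From Stdlib Require Import Reals List Arith ZArith.
From Coquelicot Require Import Coquelicot.
Open Scope R_scope.

(* Z/rZ is represented by the residues 0, ..., r - 1; only r >= 1 is meant. *)
Definition N1_zero (r : nat) : nat :=
  length (filter (fun a => Nat.eqb ((a * a) mod r) 0) (seq 0 r)).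

(* [Int_part] is the floor function; for x < 1 the sum is empty. *)
Definition sum_pos_le (f : nat -> R) (x : R) : R :=
  sum_n_m f 1 (Z.to_nat (Int_part x)).

(* Restriction of the Riemann zeta function to real s > 1, as its Dirichlet
   series; nothing is claimed about the value for s <= 1. *)
Definition zeta (s : R) : R :=
  Series (fun n => / Rpower (INR (S n)) s).

(* [real] projects the limit from [Rbar]; the term of index 0 is irrelevant. *)
Definition euler_gamma : R :=
  real (Lim_seq (fun n => sum_n_m (fun k => / INR k) 1 n - ln (INR n))).

Definition c_const : R :=
  3 / PI ^ 2 * (3 * euler_gamma - 1 - 2 * Derive zeta 2 / zeta 2).

(* Main.v *)
Require Import Defs.
From Stdlib Require Import Reals Lra Lia ZArith.
From Coquelicot Require Import Coquelicot.
From mathcomp Require Import all_boot.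
From mathcomp Require Import zify.
Open Scope R_scope.
Set Implicit Arguments.
Unset Strict Implicit.

(* Write a(r) for N_1(0, r) and A(x) for its summatory function. If r = M^2 s
   with s squarefree then a(r) = M, so that the convolution of a with the
   indicator of the squares is n |-> sum_(m^2 | n) m; in other words
   sum_d A(x / d^2) = sum_m m [x / m^2]. The hyperbola method, cut at the cube
   root of x, evaluates the right-hand side as
   G(x) = x (ln x / 2 + (3 gamma - 1) / 2) up to O(x^(2/3)).
   With B(x) = (3 / pi^2) x ln x + c x one has sum_d B(x / d^2) = G(x) exactly,
   because zeta(2) = pi^2 / 6 and zeta'(2) = - sum_n ln n / n^2. Hence E = A - B
   satisfies |sum_d E(x / d^2)| <= C x^(2/3) for all x > 0. Sieving the prime p
   out of d replaces F(x) by F(x) - F(x / p^2) and multiplies the bound by at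
   most 1 + p^(-4/3); the product over all primes converges, and in the limit
   only the term d = 1 is left, so E(x) = O(x^(2/3)). *)

(** * The convolution identity *)

Section Arithmetic.
Local Open Scope nat_scope.

Definition sqfree (s : nat) := forall t, t ^ 2 %| s -> t = 1.

Lemma sqfree_decomposition n : 0 < n -> exists M s, n = M ^ 2 * s /\ sqfree s.
Proof.
move=> n0.
have ex : exists i, i ^ 2 %| n by exists 1; rewrite exp1n dvd1n.
have bd i : i ^ 2 %| n -> i <= n.
  by move=> /(dvdn_leq n0); apply: leq_trans; rewrite -mulnn; case: i => // i; rewrite leq_pmulr.
case: (ex_maxnP ex bd) => M /dvdnP [s ns] maxM.
exists M, s; split; first by rewrite mulnC.
move=> t /dvdnP [u su].
have M0 : 0 < M by move: n0; rewrite ns; case: (M) => //; rewrite muln0.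
have : (t * M) ^ 2 %| n by rewrite ns su expnMn -mulnA dvdn_mull.
move/maxM; rewrite -{2}[M]mul1n leq_pmul2r // => t1.
case: t su t1 => [|[|]] // su _; by move: n0; rewrite ns su muln0.
Qed.

Lemma sqfree_dvd_sqr s y : 0 < s -> sqfree s -> s %| y ^ 2 -> s %| y.
Proof.
move=> s0 sf sy.
have g0 : 0 < gcdn s y by rewrite gcdn_gt0 s0.
have [s' es] := dvdnP (dvdn_gcdl s y).
have [y' ey] := dvdnP (dvdn_gcdr s y).
set g := gcdn s y in g0 es ey.
have co : coprime s' y'.
  rewrite /coprime -(eqn_pmul2r g0) mul1n muln_gcdl -es -ey; exact/eqP.
have : s' %| g.
  move: sy; rewrite es ey expnMn -(mulnn g) mulnA dvdn_pmul2r //.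
  by rewrite Gauss_dvdr // coprimeXr.
move=> /dvdnP [h gh].
have : s' = 1 by apply: sf; rewrite es gh mulnCA mulnn dvdn_mull.
by rewrite es => ->; rewrite mul1n ey dvdn_mull.
Qed.

Lemma sqr_dvd_decomposition M s d : 0 < M -> sqfree s -> (d ^ 2 %| M ^ 2 * s) = (d %| M).
Proof.
move=> M0 sf; apply/idP/idP => [|dM]; last by rewrite dvdn_mulr // dvdn_exp2r.
have g0 : 0 < gcdn d M by rewrite gcdn_gt0 M0 orbT.
have [d' ed] := dvdnP (dvdn_gcdl d M).
have [M' eM] := dvdnP (dvdn_gcdr d M).
set g := gcdn d M in g0 ed eM.
have co : coprime d' M'.
  rewrite /coprime -(eqn_pmul2r g0) mul1n muln_gcdl -ed -eM; exact/eqP.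
rewrite ed eM !expnMn mulnAC dvdn_pmul2r ?expn_gt0 ?g0 //.
rewrite Gauss_dvdr ?coprimeXl ?coprimeXr // => /sf ->.
by rewrite mul1n dvdn_mull.
Qed.

Lemma dvd_sqr_decomposition M s x : 0 < M -> 0 < s -> sqfree s ->
  (M ^ 2 * s %| x ^ 2) = (M * s %| x).
Proof.
move=> M0 s0 sf; apply/idP/idP => [dx|/dvdnP [q ->]]; last first.
  by rewrite expnMn dvdn_mull // expnMn dvdn_mul // -mulnn dvdn_mull.
have : M %| x by rewrite -(@dvdn_pexp2r _ _ 2) //; apply: dvdn_trans dx; rewrite dvdn_mulr.
move=> /dvdnP [y ey]; move: dx; rewrite ey expnMn mulnC dvdn_pmul2r ?expn_gt0 ?M0 //.
by move=> /(sqfree_dvd_sqr s0 sf); rewrite mulnC dvdn_pmul2r.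
Qed.

Lemma count_multiples m q : 0 < q -> count (fun a => q %| a) (iota 0 (m * q)) = m.
Proof.
move=> q0; elim: m => [|m IH]; first by rewrite mul0n.
rewrite mulSnr iotaD count_cat IH add0n -[X in iota _ X](prednK q0) /= dvdn_mull //.
rewrite (_ : count _ _ = 0) ?addn1 ?addn0 ?addn1 //.
apply/eqP; rewrite -leqn0 leqNgt -has_count; apply/hasPn => a.
rewrite mem_iota addSn -addnS prednK // => /andP [lo hi].
by rewrite -(subnKC (ltnW lo)) dvdn_addr ?dvdn_mull // gtnNdvd ?subn_gt0 // ltn_subLR // ltnW.
Qed.

Lemma N1_zeroE r : 0 < r -> N1_zero r = count (fun a => r %| a ^ 2) (iota 0 r).
Proof.
move=> r0; rewrite /N1_zero.
have -> : List.seq 0 r = iota 0 r by elim: r 0 {r0} => //= r IH i; rewrite IH.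
elim: (iota 0 r) => //= a l IH.
have -> : Nat.eqb ((a * a) mod r)%coq_nat 0 = (r %| a ^ 2).
  apply/Nat.eqb_spec/idP => [/Nat.Lcm0.mod_divide [q e]|/dvdnP [q e]].
    by apply/dvdnP; exists q; rewrite -mulnn.
  by apply/Nat.Lcm0.mod_divide; exists q; rewrite mulnn.
by case: ifP => _ /=; rewrite IH.
Qed.

Lemma N1_zero_decomposition M s : 0 < M -> 0 < s -> sqfree s -> N1_zero (M ^ 2 * s) = M.
Proof.
move=> M0 s0 sf; rewrite N1_zeroE ?muln_gt0 ?expn_gt0 ?M0 ?s0 //.
rewrite (eq_count (a2 := fun a => M * s %| a)); last by move=> a; exact: dvd_sqr_decomposition.
by rewrite -mulnn -mulnA count_multiples // muln_gt0 M0.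
Qed.

Lemma sum_divisors_flip M : 0 < M ->
  \sum_(d <- divisors M) M %/ d = \sum_(d <- divisors M) d.
Proof.
move=> M0; rewrite -(big_map (fun d => M %/ d) xpredT id); apply: perm_big.
have inv d : d %| M -> M %/ (M %/ d) = d.
  by move=> dM; rewrite divnA ?mulKn.
have inj : {in divisors M &, injective (fun d => M %/ d)}.
  by move=> d e; rewrite -!dvdn_divisors // => /inv {2}<- /inv {2}<- ->.
apply: uniq_perm; rewrite ?map_inj_in_uniq ?divisors_uniq // => d.
rewrite -dvdn_divisors //; apply/mapP/idP => [[e]|dM].
  by rewrite -dvdn_divisors // => eM ->; apply/dvdnP; exists e; rewrite mulnC divnK.
by exists (M %/ d); rewrite ?inv // -dvdn_divisors //; apply/dvdnP; exists d; rewrite mulnC divnK.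
Qed.

Lemma sum_dvd_divisors (F : nat -> nat) X M : 0 < M -> M <= X ->
  \sum_(1 <= d < X.+1 | d %| M) F d = \sum_(d <- divisors M) F d.
Proof.
move=> M0 MX; rewrite -big_filter; apply: perm_big; apply: uniq_perm.
- by rewrite filter_uniq // iota_uniq.
- exact: divisors_uniq.
move=> d; rewrite mem_filter -dvdn_divisors // mem_index_iota.
case dM: (d %| M) => //=; rewrite ltnS (dvdn_gt0 M0 dM) /=.
exact: leq_trans (dvdn_leq M0 dM) MX.
Qed.

Lemma sum_N1_zero_over_squares n X : 0 < n -> n <= X ->
  \sum_(1 <= d < X.+1 | d ^ 2 %| n) N1_zero (n %/ d ^ 2)
  = \sum_(1 <= d < X.+1 | d ^ 2 %| n) d.
Proof.
move=> n0 nX; have [M [s [en sf]]] := sqfree_decomposition n0.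
have M0 : 0 < M by move: n0; rewrite en; case: (M).
have s0 : 0 < s by move: n0; rewrite en; case: (s) => //; rewrite muln0.
have MX : M <= X.
  apply: leq_trans nX; rewrite en -mulnn -mulnA leq_pmulr // muln_gt0 M0 //.
have dE d : (d ^ 2 %| n) = (d %| M) by rewrite en sqr_dvd_decomposition.
rewrite !(eq_bigl _ _ dE) (sum_dvd_divisors id) // -sum_divisors_flip //.
rewrite -(sum_dvd_divisors _ M0 MX); apply: eq_bigr => d dM.
have d0 := dvdn_gt0 M0 dM.
have [q eq] := dvdnP dM.
have q0 : 0 < q by move: M0; rewrite eq; case: (q).
rewrite en eq mulnK // expnMn mulnAC mulnK ?expn_gt0 ?d0 //.
exact: N1_zero_decomposition.
Qed.

Lemma sum_quotient (f : nat -> nat) D X : 0 < D ->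
  \sum_(1 <= r < (X %/ D).+1) f r = \sum_(1 <= n < X.+1 | D %| n) f (n %/ D).
Proof.
move=> D0; elim: X => [|X IH]; first by rewrite div0n !big_nil.
rewrite [RHS]big_mkcond big_nat_recr //= -[in RHS]big_mkcond -IH divnS //.
case: ifP => dv; last by rewrite add0n addn0.
by rewrite add1n big_nat_recr //= dv.
Qed.

Lemma sum_N1_zero_convolution X :
  \sum_(1 <= d < X.+1) \sum_(1 <= r < (X %/ d ^ 2).+1) N1_zero r
  = \sum_(1 <= m < X.+1) m * (X %/ m ^ 2).
Proof.
transitivity (\sum_(1 <= n < X.+1) \sum_(1 <= d < X.+1 | d ^ 2 %| n) N1_zero (n %/ d ^ 2)).
  rewrite [RHS](exchange_big_dep_nat xpredT) //=; apply: eq_big_nat => d /andP [d0 _].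
  by rewrite sum_quotient // expn_gt0 d0.
transitivity (\sum_(1 <= n < X.+1) \sum_(1 <= d < X.+1 | d ^ 2 %| n) d).
  by apply: eq_big_nat => n /andP [n0 nX]; apply: sum_N1_zero_over_squares.
rewrite (exchange_big_dep_nat xpredT) //=; apply: eq_big_nat => d /andP [d0 _].
by rewrite -sum_quotient ?expn_gt0 ?d0 // sum_nat_const_nat subn1 mulnC.
Qed.

Lemma sum_below n X (F : nat -> nat) (P : pred nat) :
  n <= X -> (forall m, 0 < m <= X -> P m = (m <= n)) ->
  \sum_(1 <= m < X.+1 | P m) F m = \sum_(1 <= m < n.+1) F m.
Proof.
move=> nX Pn; rewrite (big_cat_nat (n := n.+1)) //=.
rewrite [X in _ + X]big1_seq ?addn0; last first.
  move=> m; rewrite mem_index_iota => /andP [Pm /andP [nm mX]].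
  have m0 : 0 < m by apply: leq_trans nm.
  by move: Pm; rewrite Pn ?m0 // leqNgt nm.
rewrite big_mkcond; apply: eq_big_nat => m /andP [m0 mn].
by rewrite Pn ?m0 /= -ltnS ?mn // (leq_trans mn) // ltnS.
Qed.

(* Dirichlet hyperbola method for the pairs (m, j) with m ^ 2 * j <= X: as both
   coordinates cannot exceed k, they are split by [m <= k] and [j <= k]. *)
Lemma sum_quotient_hyperbola k X : k ^ 3 <= X -> X < k.+1 ^ 3 ->
  \sum_(1 <= m < X.+1) m * (X %/ m ^ 2) + k * \sum_(1 <= m < k.+1) m
  = \sum_(1 <= m < k.+1) m * (X %/ m ^ 2)
    + \sum_(1 <= j < k.+1) \sum_(1 <= m < (Nat.sqrt (X %/ j)).+1) m.
Proof.
move=> kX Xk.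
have kleX : k <= X.
  by apply: leq_trans kX; case: (k) => // i; rewrite !expnS leq_pmulr // muln_gt0 expn_gt0.
pose S (P Q : pred nat) :=
  \sum_(1 <= m < X.+1 | P m) \sum_(1 <= j < X.+1 | Q j && (m ^ 2 * j <= X)) m.
have divE m j : 0 < m -> (m ^ 2 * j <= X) = (j <= X %/ m ^ 2).
  by move=> m0; rewrite leq_divRL ?expn_gt0 ?m0 // mulnC.
have quotE m : 0 < m -> m * (X %/ m ^ 2) = \sum_(1 <= j < X.+1 | m ^ 2 * j <= X) m.
  move=> m0; rewrite (sum_below (n := X %/ m ^ 2)) ?leq_div //; last by move=> j _; exact: divE.
  by rewrite sum_nat_const_nat subn1 mulnC.
have full : \sum_(1 <= m < X.+1) m * (X %/ m ^ 2) = S xpredT xpredT.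
  by rewrite /S /=; apply: eq_big_nat => m /andP [m0 _]; exact: quotE.
have low : \sum_(1 <= m < k.+1) m * (X %/ m ^ 2) = S (fun m => m <= k) xpredT.
  rewrite /S [RHS](sum_below (n := k)) //.
  by apply: eq_big_nat => m /andP [m0 _]; exact: quotE.
have left : \sum_(1 <= j < k.+1) \sum_(1 <= m < (Nat.sqrt (X %/ j)).+1) m
   = S xpredT (fun j => j <= k).
  rewrite /S [RHS](exchange_big_dep_nat (fun j => j <= k)) /=; last by move=> m j _ _ _ /andP [].
  rewrite [RHS](sum_below (n := k)) //; apply: eq_big_nat => j /andP [j0 jk].
  have sq := Nat.sqrt_spec (X %/ j) (Nat.le_0_l _).
  rewrite [RHS](sum_below (n := Nat.sqrt (X %/ j))) //.
    apply: leq_trans (leq_div X j); nia.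
  move=> m /andP [m0 _]; rewrite -ltnS jk /= -leq_divRL // -mulnn.
  by apply/idP/idP; nia.
have both : k * \sum_(1 <= m < k.+1) m = S (fun m => m <= k) (fun j => j <= k).
  rewrite /S [RHS](sum_below (n := k)) // big_distrr; apply: eq_big_nat => m /andP [m0 mk] /=.
  rewrite (sum_below (n := k)) ?sum_nat_const_nat ?subn1 //.
  move=> j /andP [j0 jX]; apply: andb_idr => jk; apply: leq_trans kX.
  by rewrite [k ^ 3]expnSr leq_mul // leq_exp2r // -ltnS.
have split2 P : S P xpredT = S P (fun j => j <= k) + S P (fun j => k < j).
  rewrite /S -big_split; apply: eq_bigr => m _ /=.
  rewrite (bigID (fun j => j <= k)) /=; congr (_ + _); apply: eq_bigl => j.
    by rewrite andbC.
  by rewrite andbC ltnNge.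
have split1 Q : S xpredT Q = S (fun m => m <= k) Q + S (fun m => k < m) Q.
  rewrite /S (bigID (fun m => m <= k)) /=; congr (_ + _); apply: eq_bigl => m.
  by rewrite ltnNge.
have empty : S (fun m => k < m) (fun j => k < j) = 0.
  rewrite /S big1_seq // => m /andP [km _]; rewrite big1_seq // => j /andP [/andP [kj le] _].
  move: le; rewrite leqNgt (leq_trans Xk) // [k.+1 ^ 3]expnSr.
  by rewrite leq_mul // leq_exp2r.
rewrite full low left both (split2 xpredT) !split1 (split2 (fun m => m <= k)).
rewrite empty; lia.
Qed.

End Arithmetic.

(** * Harmonic sums and the hyperbola method *)

Local Notation sum1 f n := (sum_n_m f 1 n : R).

Lemma sum1_0 (f : nat -> R) : sum1 f 0 = 0.
Proof. by rewrite sum_n_m_zero. Qed.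

Lemma sum1_S (f : nat -> R) n : sum1 f n.+1 = sum1 f n + f n.+1.
Proof. rewrite sum_n_Sm //; lia. Qed.

Lemma sum1_ext (f g : nat -> R) N :
  (forall n, (0 < n <= N)%N -> f n = g n) -> sum1 f N = sum1 g N.
Proof. move=> fg; apply: sum_n_m_ext_loc => n nN; apply: fg; lia. Qed.

Lemma sum1_le (f g : nat -> R) N :
  (forall n, (0 < n <= N)%N -> f n <= g n) -> sum1 f N <= sum1 g N.
Proof.
elim: N => [|N IH] fg; first by rewrite !sum1_0; lra.
rewrite !sum1_S; apply: Rplus_le_compat; last by apply: fg; lia.
by apply: IH => n nN; apply: fg; lia.
Qed.

Lemma sum1_plus (f g : nat -> R) N : sum1 (fun n => f n + g n) N = sum1 f N + sum1 g N.
Proof. exact: sum_n_m_plus. Qed.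

Lemma sum1_scal c (f : nat -> R) N : sum1 (fun n => c * f n) N = c * sum1 f N.
Proof. exact: sum_n_m_mult_l. Qed.

Lemma sum1_minus (f g : nat -> R) N : sum1 (fun n => f n - g n) N = sum1 f N - sum1 g N.
Proof.
rewrite (_ : sum1 f N - sum1 g N = sum1 f N + -1 * sum1 g N); last ring.
rewrite -sum1_scal -sum1_plus; apply: sum1_ext => n _; ring.
Qed.

Lemma sum1_Rabs_le (f g : nat -> R) N :
  (forall n, (0 < n <= N)%N -> Rabs (f n) <= g n) -> Rabs (sum1 f N) <= sum1 g N.
Proof.
elim: N => [|N IH] fg; first by rewrite !sum1_0 Rabs_R0; lra.
rewrite !sum1_S; apply: Rle_trans (Rabs_triang _ _) _.
apply: Rplus_le_compat; last by apply: fg; lia.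
by apply: IH => n nN; apply: fg; lia.
Qed.

Lemma INR_sum (f : nat -> nat) n :
  INR (\sum_(1 <= i < n.+1) f i)%N = sum1 (fun i => INR (f i)) n.
Proof.
elim: n => [|n IH]; first by rewrite big_nil sum1_0.
by rewrite big_nat_recr //= plus_INR IH sum1_S.
Qed.

Lemma sum1_INR n : sum1 INR n = INR n * (INR n + 1) / 2.
Proof.
elim: n => [|n IH]; first by rewrite sum1_0 /=; lra.
rewrite sum1_S IH S_INR; field.
Qed.

Lemma is_series_sum1 (f : nat -> R) (l : R) :
  is_series (fun n => f n.+1) l <-> is_lim_seq (fun n => sum1 f n) l.
Proof.
rewrite is_lim_seq_incr_1.
have e n : sum_n (fun n => f n.+1) n = sum1 f n.+1 by rewrite /sum_n sum_n_m_S.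
split=> h.
  exact: (is_lim_seq_ext _ _ l e h).
exact: (is_lim_seq_ext _ _ l (fun n => esym (e n)) h).
Qed.

Lemma INR_gt0 n : (0 < n)%N -> 0 < INR n.
Proof. move=> n0; apply: lt_0_INR; lia. Qed.

Lemma INR_ge1 n : (0 < n)%N -> 1 <= INR n.
Proof. move=> n0; apply: (le_INR 1); lia. Qed.

Lemma INR_expn m n : INR (m ^ n)%N = INR m ^ n.
Proof. by elim: n => [|n IH] //; rewrite expnS mult_INR IH. Qed.

Lemma ln_le_sub1 y : 0 < y -> ln y <= y - 1.
Proof. by move=> y0; move: (exp_ineq1_le (ln y)); rewrite exp_ln //; lra. Qed.

Lemma ln_le_Rpower b y : 0 < b -> 0 < y -> ln y <= Rpower y b / b.
Proof.
move=> b0 y0; have p0 : 0 < Rpower y b by exact: exp_pos.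
move: (ln_le_sub1 p0); rewrite ln_Rpower => h.
by apply/Rle_div_r => //; lra.
Qed.

Lemma ln_succ_bounds n : (0 < n)%N ->
  / (INR n + 1) <= ln (INR n + 1) - ln (INR n) <= / INR n.
Proof.
move=> /INR_gt0 n0; split.
  have q0 : 0 < INR n / (INR n + 1) by apply: Rdiv_lt_0_compat; lra.
  move: (ln_le_sub1 q0); rewrite ln_div; try lra.
  rewrite (_ : INR n / (INR n + 1) - 1 = - / (INR n + 1)); [lra | field; lra].
have q0 : 0 < (INR n + 1) / INR n by apply: Rdiv_lt_0_compat; lra.
move: (ln_le_sub1 q0); rewrite ln_div; try lra.
rewrite (_ : (INR n + 1) / INR n - 1 = / INR n); [lra | field; lra].
Qed.

Lemma harmonic_bounds n : (0 < n)%N ->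
  0 <= sum1 (fun k => / INR k) n - ln (INR n) - euler_gamma <= / INR n.
Proof.
pose u n := sum1 (fun k => / INR k) n - ln (INR n).
have decr m : u m.+2 <= u m.+1.
  have := @ln_succ_bounds m.+1 isT; rewrite /u (sum1_S _ m.+1) !(S_INR m.+1); lra.
have incr m : u m.+1 - / INR m.+1 <= u m.+2 - / INR m.+2.
  have := @ln_succ_bounds m.+1 isT; rewrite /u (sum1_S _ m.+1) !(S_INR m.+1); lra.
have ge0 m : 0 <= u m.+1 - / INR m.+1.
  elim: m => [|m IH]; last by have := incr m; lra.
  by rewrite /u sum1_S sum1_0 /= ln_1; lra.
have inv0 m : 0 < / INR m.+1 by apply: Rinv_0_lt_compat; exact: INR_gt0.
have [l hl] : ex_finite_lim_seq (fun m => u m.+1).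
  by apply: (ex_finite_lim_seq_decr _ 0) => m //; have := ge0 m; have := inv0 m; lra.
have gl : euler_gamma = l.
  by rewrite /euler_gamma (is_lim_seq_unique _ l) //; apply/is_lim_seq_incr_1.
have hl' : is_lim_seq (fun m => u m.+1 - / INR m.+1) l.
  rewrite -[l]Rminus_0_r; apply: is_lim_seq_minus' => //.
  apply: (is_lim_seq_inv _ p_infty) => //; apply/(is_lim_seq_incr_1 INR); exact: is_lim_seq_INR.
case: n => // n _; rewrite gl -/(u n.+1).
have := is_lim_seq_decr_compare _ _ hl decr n.
have := is_lim_seq_incr_compare _ _ hl' incr n.
lra.
Qed.

Lemma sum_Rpower_le a N : 0 < a ->
  sum1 (fun n => Rpower (INR n) (- (1 + a))) N <= 1 + / a.
Proof.
move=> a0; have ia : 0 < / a by apply: Rinv_0_lt_compat.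
case: N => [|N]; first by rewrite sum1_0; lra.
suff : sum1 (fun n => Rpower (INR n) (- (1 + a))) N.+1
       <= 1 + / a - / a * Rpower (INR N.+1) (- a).
  have : 0 < / a * Rpower (INR N.+1) (- a) by apply: Rmult_lt_0_compat => //; exact: exp_pos.
  lra.
elim: N => [|N IH].
  by rewrite sum1_S sum1_0 /= /Rpower ln_1 !Rmult_0_r exp_0; lra.
rewrite sum1_S S_INR; set n := INR N.+1 in IH *.
have n0 : 0 < n by exact: INR_gt0.
have [lo _] := @ln_succ_bounds N.+1 isT; rewrite -/n in lo.
suff : a * Rpower (n + 1) (- (1 + a)) <= Rpower n (- a) - Rpower (n + 1) (- a).
  move=> h; have := Rmult_le_compat_l _ _ _ (Rlt_le _ _ ia) h.
  rewrite -Rmult_assoc Rinv_l; lra.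
have p0 : 0 < Rpower (n + 1) (- a) by exact: exp_pos.
have -> : Rpower (n + 1) (- (1 + a)) = Rpower (n + 1) (- a) * / (n + 1).
  rewrite (_ : - (1 + a) = - a + - (1)); last ring.
  by rewrite Rpower_plus (Rpower_Ropp _ 1) Rpower_1 //; lra.
have -> : Rpower n (- a) = Rpower (n + 1) (- a) * exp (a * (ln (n + 1) - ln n)).
  rewrite /Rpower -exp_plus; congr exp; ring.
have := exp_ineq1_le (a * (ln (n + 1) - ln n)).
have := Rmult_le_compat_l _ _ _ (Rlt_le _ _ a0) lo.
nra.
Qed.

Lemma ex_series_Rpower s : 1 < s -> ex_series (fun n => Rpower (INR n.+1) (- s)).
Proof.
move=> s1.
have [l hl] : ex_finite_lim_seq (fun N => sum1 (fun n => Rpower (INR n) (- s)) N).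
  apply: (ex_finite_lim_seq_incr _ (1 + / (s - 1))) => N.
    by rewrite sum1_S; have : 0 < Rpower (INR N.+1) (- s); [exact: exp_pos | lra].
  have := @sum_Rpower_le (s - 1) N; rewrite (_ : 1 + (s - 1) = s); [apply; lra | ring].
by exists l; apply/(is_series_sum1 (fun n => Rpower (INR n) (- s))).
Qed.

Lemma Rpower_neg2 n : Rpower (INR n.+1) (- (2)) = / INR n.+1 ^ 2.
Proof. rewrite Rpower_Ropp (_ : 2 = INR 2) ?Rpower_pow //; exact: INR_gt0. Qed.

Lemma ex_series_inv_sqr : ex_series (fun n => / INR n.+1 ^ 2).
Proof.
by apply: ex_series_ext (@ex_series_Rpower 2 ltac:(lra)) => n; rewrite Rpower_neg2.
Qed.

Lemma sum_inv_sqrt_le N : sum1 (fun n => / sqrt (INR n)) N <= 2 * sqrt (INR N).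
Proof.
elim: N => [|N IH]; first by rewrite sum1_0 /= sqrt_0; lra.
rewrite sum1_S; apply: Rle_trans (Rplus_le_compat_r _ _ _ IH) _.
have n0 := pos_INR N; rewrite S_INR.
set a := sqrt (INR N); set b := sqrt (INR N + 1).
have a2 : a * a = INR N by apply: sqrt_sqrt.
have b2 : b * b = INR N + 1 by apply: sqrt_sqrt; lra.
have a0 : 0 <= a by exact: sqrt_pos.
have b0 : 0 < b by apply: sqrt_lt_R0; lra.
apply: (Rmult_le_reg_r b) => //; rewrite Rmult_plus_distr_r Rinv_l; nra.
Qed.

Lemma pow2_le_Rpower_cube k x : (0 < k)%N -> INR k ^ 3 <= x -> INR k ^ 2 <= Rpower x (2 / 3).
Proof.
move=> /INR_gt0 k0 kx.
have -> : INR k ^ 2 = Rpower (INR k ^ 3) (2 / 3).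
  rewrite -!Rpower_pow // Rpower_mult; congr Rpower; rewrite /=; field.
apply: Rle_Rpower_l; first lra.
by split=> //; apply: pow_lt.
Qed.

Definition square_quotient_sum X := (\sum_(1 <= m < X.+1) m * (X %/ m ^ 2))%N.

Lemma square_quotient_sum_cube_bound k X x : (0 < k)%N ->
  (k ^ 3 <= X)%N -> (X < k.+1 ^ 3)%N -> INR X <= x < INR X + 1 ->
  Rabs (INR (square_quotient_sum X) - x * (ln x / 2 + (3 * euler_gamma - 1) / 2))
  <= 20 * INR k ^ 2.
Proof.
move=> k0 kX Xk [Xx xX].
have k1 := INR_ge1 k0.
have kx : INR k ^ 3 <= x.
  by rewrite -INR_expn; apply: Rle_trans Xx; apply: le_INR; lia.
have xk : x < (INR k + 1) ^ 3.
  rewrite -S_INR -INR_expn; apply: Rlt_le_trans xX _; rewrite -S_INR; apply: le_INR; lia.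
have x0 : 0 < x by apply: Rlt_le_trans kx; apply: pow_lt; lra.
have x8 : x <= 8 * INR k ^ 3 by nra.
have := f_equal INR (sum_quotient_hyperbola kX Xk).
rewrite -/(square_quotient_sum X) !plus_INR mult_INR !INR_sum sum1_INR => GE.
set H := sum1 (fun k => / INR k) k.
set S1 := sum1 (fun m => INR (m * _)) k in GE.
set S2 := sum1 _ k in GE.
have b1 : x * H - INR k ^ 2 <= S1 <= x * H.
  have q m : (0 < m <= k)%N -> x * / INR m - INR m <= INR (m * (X %/ m ^ 2)) <= x * / INR m.
    move=> /andP [m0 _]; have m1 := INR_gt0 m0.
    set q := (X %/ m ^ 2)%N.
    have lo : (q * m ^ 2 <= X)%N by exact: leq_trunc_div.
    have hi : (X < q.+1 * m ^ 2)%N by apply: ltn_ceil; rewrite expn_gt0 m0.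
    have lo' : INR q * INR m ^ 2 <= x.
      by apply: Rle_trans Xx; rewrite -INR_expn -mult_INR; apply: le_INR; lia.
    have hi' : x < (INR q + 1) * INR m ^ 2.
      apply: Rlt_le_trans xX _.
      by rewrite -INR_expn -!S_INR -mult_INR; apply: le_INR; lia.
    rewrite mult_INR; split; apply: (Rmult_le_reg_r (INR m)) => //.
      rewrite Rmult_minus_distr_r Rmult_assoc Rinv_l; nra.
    rewrite (Rmult_assoc x) Rinv_l; nra.
  split.
    apply: Rle_trans (sum1_le (fun m mk => proj1 (q m mk))).
    rewrite sum1_minus sum1_scal sum1_INR -/H; nra.
  apply: Rle_trans (sum1_le (fun m mk => proj2 (q m mk))) _.
  rewrite sum1_scal -/H; lra.
have b2 : Rabs (S2 - x / 2 * H) <= 3 * INR k ^ 2.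
  have q n : (0 < n <= k)%N ->
     Rabs (INR (\sum_(1 <= m < (Nat.sqrt (X %/ n)).+1) m)%N - x / 2 * / INR n)
     <= sqrt x / 2 * / sqrt (INR n).
    move=> /andP [n0 nk]; have n1 := INR_gt0 n0.
    rewrite INR_sum sum1_INR; set j := Nat.sqrt _.
    have [sl sh] := Nat.sqrt_spec (X %/ n) (Nat.le_0_l _); rewrite -/j in sl sh.
    have lo : (j * j * n <= X)%N by rewrite -leq_divRL //; lia.
    have hi : (X < j.+1 * j.+1 * n)%N by rewrite -ltn_divLR //; lia.
    have j0 := pos_INR j.
    have lo' : INR j * INR j * INR n <= x.
      by apply: Rle_trans Xx; rewrite -!mult_INR; apply: le_INR; lia.
    have hi' : x < (INR j + 1) * (INR j + 1) * INR n.
      apply: Rlt_le_trans xX _.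
      by rewrite -!S_INR -!mult_INR; apply: le_INR; lia.
    rewrite /Rdiv (Rmult_assoc (sqrt x)) (Rmult_comm (/ 2)) -Rmult_assoc -/(Rdiv (sqrt x) _).
    rewrite -sqrt_div_alt //; set y := sqrt (x / INR n).
    have y0 : 0 <= y by exact: sqrt_pos.
    have y2 : y * y = x / INR n by apply: sqrt_sqrt; apply: Rlt_le; apply: Rdiv_lt_0_compat.
    have jy : INR j <= y.
      apply: Rsqr_incr_0_var => //; rewrite /Rsqr y2; apply/(Rle_div_r _ _ (INR n)) => //; lra.
    have yj : y <= INR j + 1.
      apply: Rsqr_incr_0_var; last lra; rewrite /Rsqr y2; apply/(Rle_div_l _ _ (INR n)) => //; lra.
    rewrite (_ : x * / 2 * / INR n = y * y / 2); last by rewrite y2; field; lra.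
    apply: Rabs_le; nra.
  rewrite -sum1_scal -sum1_minus.
  apply: Rle_trans (sum1_Rabs_le q) _; rewrite sum1_scal.
  apply: Rle_trans (_ : sqrt x / 2 * (2 * sqrt (INR k)) <= _).
    apply: Rmult_le_compat_l; last exact: sum_inv_sqrt_le.
    have := sqrt_pos x; lra.
  rewrite (_ : sqrt x / 2 * (2 * sqrt (INR k)) = sqrt x * sqrt (INR k)); last field.
  rewrite -sqrt_mult; [|lra..].
  rewrite -(sqrt_pow2 (3 * INR k ^ 2)); last nra.
  apply: sqrt_le_1_alt.
  have : x * INR k <= 8 * INR k ^ 3 * INR k by apply: Rmult_le_compat_r; lra.
  nra.
have b3 : Rabs (INR k * (INR k * (INR k + 1) / 2) - x / 2) <= 4 * INR k ^ 2.
  by apply: Rabs_le; nra.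
have b4 : Rabs (x * H - x * (ln x / 3 + euler_gamma)) <= 8 * INR k ^ 2.
  have hb := harmonic_bounds k0; rewrite -/H in hb.
  have lb := ln_succ_bounds k0.
  have ln3 y : 0 < y -> ln (y ^ 3) = 3 * ln y.
    by move=> y0; rewrite ln_pow // (_ : INR 3 = 3) //=; lra.
  have l3 := @ln3 (INR k) ltac:(lra).
  have l3' := @ln3 (INR k + 1) ltac:(lra).
  have m1 : ln (INR k ^ 3) <= ln x by apply: ln_le => //; apply: pow_lt; lra.
  have m2 : ln x <= ln ((INR k + 1) ^ 3) by apply: ln_le => //; lra.
  have ik : 0 < / INR k by apply: Rinv_0_lt_compat; lra.
  rewrite -Rmult_minus_distr_l Rabs_mult (Rabs_pos_eq x); last lra.
  apply: Rle_trans (_ : x * / INR k <= _).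
    apply: Rmult_le_compat_l; first lra.
    apply: Rabs_le; lra.
  apply: (Rmult_le_reg_r (INR k)); first lra.
  rewrite Rmult_assoc Rinv_l; nra.
move: b2 b3 b4 => /Rabs_le_between b2 /Rabs_le_between b3 /Rabs_le_between b4.
apply: Rabs_le; split; lra.
Qed.

(** * The summatory function over rescaled arguments *)

Definition floor_nat (y : R) : nat := Z.to_nat (Int_part y).

Lemma floor_nat_bounds y : 0 <= y -> INR (floor_nat y) <= y < INR (floor_nat y) + 1.
Proof.
move=> y0; have [lo hi] := base_Int_part y.
have i0 : (0 <= Int_part y)%Z.
  have : (-1 < Int_part y)%Z by apply: lt_IZR; lra.
  lia.
rewrite INR_IZR_INZ /floor_nat Z2Nat.id //; lra.
Qed.

Lemma floor_nat_unique n y : INR n <= y < INR n + 1 -> floor_nat y = n.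
Proof.
rewrite INR_IZR_INZ => ny; rewrite /floor_nat -(@Int_part_spec y (Z.of_nat n)); last lra.
exact: Nat2Z.id.
Qed.

Lemma floor_nat_le x y : 0 <= x <= y -> (floor_nat x <= floor_nat y)%N.
Proof.
move=> xy; have [lo _] := @floor_nat_bounds x ltac:(lra).
have [_ hi] := @floor_nat_bounds y ltac:(lra).
have : INR (floor_nat x) < INR (floor_nat y).+1 by rewrite S_INR; lra.
move/INR_lt; lia.
Qed.

Lemma floor_nat_div_sqr x d : 0 <= x -> (0 < d)%N ->
  floor_nat (x / INR d ^ 2) = (floor_nat x %/ d ^ 2)%N.
Proof.
move=> x0 d0; have [lo hi] := floor_nat_bounds x0; apply: floor_nat_unique.
set X := floor_nat x in lo hi *; set q := (X %/ d ^ 2)%N.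
have d2 : 0 < INR d ^ 2 by apply: pow_lt; exact: INR_gt0.
have ql : (q * d ^ 2 <= X)%N by exact: leq_trunc_div.
have qh : (X < q.+1 * d ^ 2)%N by apply: ltn_ceil; rewrite expn_gt0 d0.
split.
  apply/(Rle_div_r _ _ (INR d ^ 2)) => //; apply: Rle_trans lo.
  by rewrite -INR_expn -mult_INR; apply: le_INR; lia.
apply/(Rlt_div_l _ _ (INR d ^ 2)) => //; apply: Rlt_le_trans hi _.
by rewrite -INR_expn -!S_INR -mult_INR; apply: le_INR; lia.
Qed.

Definition N1_zero_sum (y : R) : R := sum_pos_le (fun r => INR (N1_zero r)) y.

Lemma N1_zero_sumE y : N1_zero_sum y = INR (\sum_(1 <= r < (floor_nat y).+1) N1_zero r)%N.
Proof. by rewrite INR_sum. Qed.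

Lemma N1_zero_sum_lt1 y : 0 <= y < 1 -> N1_zero_sum y = 0.
Proof.
move=> y1; rewrite N1_zero_sumE (_ : floor_nat y = 0%N) ?big_nil //.
by apply: floor_nat_unique; rewrite /=; lra.
Qed.

Lemma is_series_N1_zero_sum x : 0 < x ->
  is_series (fun n => N1_zero_sum (x / INR n.+1 ^ 2)) (INR (square_quotient_sum (floor_nat x))).
Proof.
move=> x0; set X := floor_nat x.
apply/(is_series_sum1 (fun n => N1_zero_sum (x / INR n ^ 2))).
apply: (is_lim_seq_ext_loc (fun _ => INR (square_quotient_sum X))); last exact: is_lim_seq_const.
exists X => N /leP XN; rewrite -(subnKC XN).
elim: (N - X)%N => [|m IH].
  rewrite addn0 /square_quotient_sum -sum_N1_zero_convolution INR_sum.
  apply: sum1_ext => d /andP [d0 _].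
  by rewrite N1_zero_sumE floor_nat_div_sqr //; lra.
rewrite addnS sum1_S -IH N1_zero_sumE floor_nat_div_sqr //; last lra.
rewrite divn_small ?big_nil /= ?Rplus_0_r //.
by rewrite -/X; nia.
Qed.

Lemma exists_cube_root X : exists k, (k ^ 3 <= X)%N /\ (X < k.+1 ^ 3)%N.
Proof.
elim: X => [|X [k [lo hi]]]; first by exists 0%N.
case: (ltnP X.+1 (k.+1 ^ 3)) => h; first by exists k; split=> //; exact: leqW.
exists k.+1; split=> //; apply: leq_ltn_trans hi _; by rewrite ltn_exp2r.
Qed.

Lemma Rpower_ge1 x e : 0 <= e -> 1 <= x -> 1 <= Rpower x e.
Proof.
move=> e0 x1; have : 1 <= exp (e * ln x); last by [].
have l0 : 0 <= ln x by rewrite -ln_1; apply: ln_le; lra.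
have := exp_ineq1_le (e * ln x); have : 0 <= e * ln x by nra.
lra.
Qed.

Lemma Rabs_xlnx_le y : 0 < y ->
  Rabs (y * ln y) <= 3 * (Rpower y (2 / 3) * Rpower y (2 / 3) + Rpower y (2 / 3)).
Proof.
move=> y0; set t := Rpower y (1 / 3).
have t0 : 0 < t by exact: exp_pos.
have t3 : y = t * t * t.
  rewrite -!Rpower_plus (_ : 1 / 3 + 1 / 3 + 1 / 3 = 1); [by rewrite Rpower_1 | field].
have -> : Rpower y (2 / 3) = t * t by rewrite -Rpower_plus; congr Rpower; field.
have up : ln y <= 3 * t.
  have := @ln_le_Rpower (1 / 3) y ltac:(lra) y0; rewrite -/t; lra.
have lo : - ln y <= 3 * / t.
  have iy : 0 < / y by apply: Rinv_0_lt_compat.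
  have := @ln_le_Rpower (1 / 3) (/ y) ltac:(lra) iy.
  rewrite /Rpower ln_Rinv // Ropp_mult_distr_r_reverse exp_Ropp -/(Rpower y (1 / 3)) -/t; lra.
have it : t * / t = 1 by apply: Rinv_r; lra.
have it0 : 0 < / t by apply: Rinv_0_lt_compat.
have tt : 0 < t * t by nra.
have h1 : y * - ln y <= 3 * (t * t).
  apply: Rle_trans (Rmult_le_compat_l _ _ _ (Rlt_le _ _ y0) lo) _; apply: Req_le.
  by rewrite {1}t3 -[RHS]Rmult_1_r -it; ring.
have h2 : y * ln y <= 3 * (t * t * (t * t)).
  apply: Rle_trans (Rmult_le_compat_l _ _ _ (Rlt_le _ _ y0) up) _; apply: Req_le.
  by rewrite {1}t3; ring.
apply: Rabs_le; nra.
Qed.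

Lemma xlnx_main_growth a b X : 0 < X -> exists K, 0 <= K /\
  forall y, 0 < y <= X -> Rabs (y * (a * ln y + b)) <= K * Rpower y (2 / 3).
Proof.
move=> X0; set M := Rpower X (2 / 3); set N := Rpower X (1 / 3).
have M0 : 0 < M by exact: exp_pos.
have N0 : 0 < N by exact: exp_pos.
have a0 := Rabs_pos a; have b0 := Rabs_pos b.
exists (Rabs a * (3 * (M + 1)) + Rabs b * N); split; first nra.
move=> y [y0 yX].
rewrite (_ : y * (a * ln y + b) = a * (y * ln y) + b * y); last ring.
apply: Rle_trans (Rabs_triang _ _) _; rewrite (Rabs_mult a) (Rabs_mult b).
have p0 : 0 < Rpower y (2 / 3) by exact: exp_pos.
have yM : Rpower y (2 / 3) <= M by apply: Rle_Rpower_l; lra.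
have yN : Rpower y (1 / 3) <= N by apply: Rle_Rpower_l; lra.
have yE : Rabs y = Rpower y (2 / 3) * Rpower y (1 / 3).
  rewrite -Rpower_plus (_ : 2 / 3 + 1 / 3 = 1); last field.
  by rewrite Rpower_1 // Rabs_pos_eq //; lra.
have h := Rabs_xlnx_le y0.
rewrite yE Rmult_plus_distr_r; apply: Rplus_le_compat.
  rewrite Rmult_assoc; apply: Rmult_le_compat_l => //; nra.
rewrite Rmult_assoc; apply: Rmult_le_compat_l => //; nra.
Qed.

Lemma square_quotient_sum_asymptotic : exists C, 0 <= C /\ forall y, 0 < y ->
  Rabs (INR (square_quotient_sum (floor_nat y)) - y * (ln y / 2 + (3 * euler_gamma - 1) / 2))
  <= C * Rpower y (2 / 3).
Proof.
have [K [K0 HK]] := @xlnx_main_growth (/ 2) ((3 * euler_gamma - 1) / 2) 1 Rlt_0_1.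
exists (K + 20); split; first lra.
move=> y y0; have p0 : 0 < Rpower y (2 / 3) by exact: exp_pos.
case: (Rlt_le_dec y 1) => y1.
  have -> : floor_nat y = 0%N by apply: floor_nat_unique; rewrite /=; lra.
  have := HK y ltac:(lra).
  rewrite /square_quotient_sum big_nil [INR 0]/= Rminus_0_l Rabs_Ropp.
  rewrite (_ : / 2 * ln y = ln y / 2); last field.
  nra.
have fb := @floor_nat_bounds y ltac:(lra).
have [k [lo hi]] := exists_cube_root (floor_nat y).
have k0 : (0 < k)%N.
  have : INR 0 < INR (floor_nat y) by rewrite [INR 0]/=; lra.
  by move/INR_lt => f0; case: (k) hi => //; rewrite exp1n; lia.
apply: Rle_trans (square_quotient_sum_cube_bound k0 lo hi fb) _.
have : INR k ^ 2 <= Rpower y (2 / 3).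
  apply: pow2_le_Rpower_cube => //; apply: Rle_trans (proj1 fb).
  by rewrite -INR_expn; apply: le_INR; lia.
nra.
Qed.

Lemma N1_zero_sum_growth X : 0 < X -> exists K, 0 <= K /\
  forall y, 0 < y <= X -> Rabs (N1_zero_sum y) <= K * Rpower y (2 / 3).
Proof.
move=> X0; exists (N1_zero_sum X); split; first by rewrite N1_zero_sumE; exact: pos_INR.
move=> y [y0 yX]; have p0 : 0 < Rpower y (2 / 3) by exact: exp_pos.
have A0 : 0 <= N1_zero_sum X by rewrite N1_zero_sumE; exact: pos_INR.
case: (Rlt_le_dec y 1) => y1; first by rewrite N1_zero_sum_lt1 ?Rabs_R0; nra.
rewrite Rabs_pos_eq; last by rewrite N1_zero_sumE; exact: pos_INR.
have : N1_zero_sum y <= N1_zero_sum X.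
  rewrite !N1_zero_sumE; apply: le_INR; apply/leP.
  rewrite [X in (_ <= X)%N](big_cat_nat (n := (floor_nat y).+1)) //= ?leq_addr //.
  by rewrite ltnS; apply: floor_nat_le; lra.
have := @Rpower_ge1 y (2 / 3) ltac:(lra) y1.
nra.
Qed.

(** * Inversion by sieving *)

Lemma Rpower_div_sqr x e n : 0 < x -> (0 < n)%N ->
  Rpower (x / INR n ^ 2) e = Rpower x e * Rpower (INR n) (- (2 * e)).
Proof.
move=> x0 /INR_gt0 n0; rewrite /Rpower -exp_plus; congr exp.
rewrite ln_div //; last exact: pow_lt.
rewrite ln_pow // (_ : INR 2 = 2) //; ring.
Qed.

Lemma div_sqr_pos x n : 0 < x -> (0 < n)%N -> 0 < x / INR n ^ 2 <= x.
Proof.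
move=> x0 n0; have n1 := INR_ge1 n0.
split; first by apply: Rdiv_lt_0_compat => //; apply: pow_lt; lra.
apply/(Rle_div_l _ _ (INR n ^ 2)); first by apply: pow_lt; lra.
have : 1 <= INR n ^ 2 by nra.
nra.
Qed.

Lemma sum1_multiples (f : nat -> R) p N : (0 < p)%N ->
  sum1 (fun n => if p %| n then f n else 0) N = sum1 (fun m => f (p * m)%N) (N %/ p).
Proof.
move=> p0; elim: N => [|N IH]; first by rewrite div0n !sum1_0.
rewrite sum1_S IH divnS //; case: ifP => [dv|_]; last by rewrite Rplus_0_r.
rewrite add1n sum1_S; congr (_ + f _).
by rewrite -[in LHS](divnK dv) divnS // dv add1n mulnC.
Qed.

Lemma Series_multiples (f : nat -> R) p : (0 < p)%N ->
  ex_series (fun n => if p %| n.+1 then f n.+1 else 0) ->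
  Series (fun n => if p %| n.+1 then f n.+1 else 0) = Series (fun n => f (p * n.+1)%N).
Proof.
move=> p0 [l hl]; rewrite (is_series_unique _ _ hl); symmetry; apply: is_series_unique.
apply/(is_series_sum1 (fun n => f (p * n)%N)).
move/(is_series_sum1 (fun n => if p %| n then f n else 0)) in hl.
apply: (is_lim_seq_ext (fun N => sum1 (fun n => if p %| n then f n else 0) (p * N)%N)) => [N|].
  by rewrite sum1_multiples // mulKn.
apply: (is_lim_seq_subseq (sum_n_m (fun n => if p %| n then f n else 0) 1) _
  (fun N => (p * N)%N)) => //.
apply: eventually_subseq => n; nia.
Qed.

Definition rough k d := all (fun p => k < p)%N (primes d).

Lemma roughS k d : (0 < d)%N -> rough k.+1 d = rough k d && ~~ (prime k.+1 && (k.+1 %| d)).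
Proof.
move=> d0; apply/allP/andP => [h|[/allP h nd] p pd].
  split; first by apply/allP => p /h; exact: ltnW.
  apply/negP => /andP [pk kd].
  by have := h k.+1; rewrite mem_primes pk d0 kd ltnn => /(_ isT).
rewrite ltn_neqAle h // andbT; apply/eqP => e.
by move: pd nd; rewrite mem_primes -e d0 /= => /andP [-> ->].
Qed.

Lemma rough_prime_mul k d : (0 < d)%N -> prime k.+1 -> rough k (k.+1 * d) = rough k d.
Proof.
move=> d0 pk; rewrite /rough; apply/allP/allP => h p; rewrite ?primesM //.
  by move=> pd; apply: h; rewrite primesM // pd orbT.
rewrite primes_prime // inE => /orP [/eqP -> //|]; exact: h.
Qed.

Lemma rough1 k : rough k 1. Proof. by []. Qed.

Lemma rough_small k d : (1 < d)%N -> (d <= k)%N -> rough k d = false.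
Proof.
move=> d1 dk; apply/negP => /allP h.
have := h (pdiv d); rewrite mem_primes pdiv_prime // pdiv_dvd ltnW // => /(_ isT).
by rewrite ltnNge (leq_trans (pdiv_leq (ltnW d1))).
Qed.

Section Sieve.
Variables (E : R -> R) (e C : R).
Hypothesis e2 : / 2 < e.
Hypothesis C0 : 0 <= C.
Hypothesis growth : forall X, 0 < X -> exists K, 0 <= K /\
  forall y, 0 < y <= X -> Rabs (E y) <= K * Rpower y e.
Hypothesis bound : forall x, 0 < x ->
  Rabs (Series (fun n => E (x / INR n.+1 ^ 2))) <= C * Rpower x e.

Definition sifted (P : pred nat) x n := if P n.+1 then E (x / INR n.+1 ^ 2) else 0.

Lemma sifted_le x : 0 < x -> exists K, 0 <= K /\ forall P n,
  Rabs (sifted P x n) <= K * Rpower (INR n.+1) (- (2 * e)).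
Proof.
move=> x0; have [K [K0 HK]] := growth x0.
have p0 : 0 < Rpower x e by exact: exp_pos.
exists (K * Rpower x e); split=> [|P n]; first nra.
have q0 : 0 < Rpower (INR n.+1) (- (2 * e)) by exact: exp_pos.
rewrite /sifted; case: ifP => _; last first.
  by rewrite Rabs_R0; apply: Rmult_le_pos; nra.
by rewrite Rmult_assoc -Rpower_div_sqr //; apply: HK; exact: div_sqr_pos.
Qed.

Lemma ex_series_sifted P x : 0 < x -> ex_series (sifted P x).
Proof.
move=> /sifted_le [K [K0 HK]].
apply: (ex_series_le _ (fun n => K * Rpower (INR n.+1) (- (2 * e)))) => [n|]; first exact: HK.
apply: (ex_series_scal_l K); apply: ex_series_Rpower; lra.
Qed.

Lemma sifted_step_prime k x : 0 < x -> prime k.+1 ->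
  Series (sifted (rough k.+1) x)
  = Series (sifted (rough k) x) - Series (sifted (rough k) (x / INR k.+1 ^ 2)).
Proof.
move=> x0 pk.
pose f n := if rough k n then E (x / INR n ^ 2) else 0.
have exm : ex_series (fun n => if k.+1 %| n.+1 then f n.+1 else 0).
  apply: ex_series_ext (ex_series_sifted [pred n | (k.+1 %| n) && rough k n] x0) => n.
  by rewrite /sifted /f /=; case: (_ %| _).
have -> : Series (sifted (rough k) (x / INR k.+1 ^ 2)) = Series (fun n => f (k.+1 * n.+1)%N).
  apply: Series_ext => n; rewrite /sifted /f rough_prime_mul //.
  case: ifP => // _; congr E; rewrite mult_INR; field.
  split; apply: not_0_INR; lia.
rewrite -Series_multiples // -Series_minus //; last exact: ex_series_sifted.
apply: Series_ext => n; rewrite /sifted /f roughS // pk /=.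
by case: (rough k _); case: (_ %| _) => /=; lra.
Qed.

Lemma sifted_bound k x : 0 < x -> Rabs (Series (sifted (rough k) x))
  <= C * exp (sum1 (fun n => Rpower (INR n) (- (2 * e))) k) * Rpower x e.
Proof.
elim: k x => [|k IH] x x0.
  rewrite sum1_0 exp_0 Rmult_1_r.
  rewrite (Series_ext _ (fun n => E (x / INR n.+1 ^ 2))); first exact: bound.
  move=> n; rewrite /sifted (_ : rough 0 n.+1) //.
  by apply/allP => p; rewrite mem_primes => /andP [/prime_gt0].
rewrite sum1_S exp_plus; set r := Rpower (INR k.+1) _; set S := exp (sum1 _ _).
have r0 : 0 < r by exact: exp_pos.
have S0 : 0 < S by exact: exp_pos.
have x1 : 0 < Rpower x e by exact: exp_pos.
have er : 1 + r <= exp r by exact: exp_ineq1_le.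
have b1 := IH x x0; rewrite -/S in b1.
have CS : 0 <= C * S * Rpower x e by apply: Rmult_le_pos; nra.
have goalE : C * S * Rpower x e * (1 + r) <= C * (S * exp r) * Rpower x e by nra.
apply: Rle_trans goalE.
case pk: (prime k.+1).
  have [y0 _] := @div_sqr_pos x k.+1 x0 isT.
  have b2 := IH _ y0; rewrite Rpower_div_sqr // -/r -/S in b2.
  rewrite sifted_step_prime //; apply: Rle_trans (Rabs_triang _ _) _.
  rewrite Rabs_Ropp; nra.
rewrite (Series_ext _ (sifted (rough k) x)); first nra.
by move=> n; rewrite /sifted roughS // pk andbT.
Qed.

(* Letting k grow, the k-rough numbers shrink to {1}. *)
Lemma sieve_bound x : 0 < x -> Rabs (E x) <= C * exp (1 + / (2 * e - 1)) * Rpower x e.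
Proof.
move=> x0; set B := C * exp _ * _.
have [K [K0 HK]] := sifted_le x0.
pose g n := Rpower (INR n.+1) (- (2 * e)).
have exg : ex_series g by apply: ex_series_Rpower; lra.
have g0 n : 0 < g n by exact: exp_pos.
have key k : Rabs (E x) <= B + K * (Series g - sum_n g k).
  pose f := sifted (rough k.+1) x.
  have exf : ex_series f by exact: ex_series_sifted.
  have fE : Series f = E x + Series (fun n => f (k.+1 + n)%N).
    rewrite (Series_incr_n _ k.+1) //; last lia.
    congr (_ + _); rewrite /=.
    have f0 : f 0%N = E x by rewrite /f /sifted rough1 /=; congr E; field.
    have : forall j, (j <= k)%N -> sum_f_R0 f j = E x.
      elim=> [|j IH] jk //=; rewrite IH ?(ltnW jk) //.
      by rewrite /f /sifted rough_small // Rplus_0_r.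
    by apply.
  have gE : Series g - sum_n g k = Series (fun n => g (k.+1 + n)%N).
    rewrite (Series_incr_n g k.+1) //; last lia.
    rewrite sum_n_Reals; exact: Rplus_minus_l.
  have exg' : ex_series (fun n => K * g (k.+1 + n)%N).
    by apply: (ex_series_scal_l K); apply/(ex_series_incr_n g k.+1).
  have tail : Rabs (Series (fun n => f (k.+1 + n)%N)) <= K * (Series g - sum_n g k).
    rewrite gE -Series_scal_l.
    have exa : ex_series (fun n => Rabs (f (k.+1 + n)%N)).
      apply: (ex_series_le _ _ _ exg') => n; rewrite /norm /= /abs /= Rabs_Rabsolu; exact: HK.
    apply: Rle_trans (Series_Rabs _ exa) _.
    by apply: Series_le => // n; split; [exact: Rabs_pos | exact: HK].
  have main : Rabs (Series f) <= B.
    apply: Rle_trans (sifted_bound _ x0) _; rewrite /B.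
    apply: Rmult_le_compat_r; first by apply: Rlt_le; exact: exp_pos.
    apply: Rmult_le_compat_l => //.
    have := @sum_Rpower_le (2 * e - 1) k.+1 ltac:(lra).
    rewrite (_ : 1 + (2 * e - 1) = 2 * e); last ring.
    case=> [h|->]; last lra.
    by apply: Rlt_le; apply: exp_increasing.
  have -> : E x = Series f - Series (fun n => f (k.+1 + n)%N) by rewrite fE; ring.
  apply: Rle_trans (Rabs_triang _ _) _; rewrite Rabs_Ropp; lra.
have lim : is_lim_seq (fun k => B + K * (Series g - sum_n g k)) (B + K * (Series g - Series g)).
  apply: is_lim_seq_plus'; first exact: is_lim_seq_const.
  apply: is_lim_seq_mult'; first exact: is_lim_seq_const.
  apply: is_lim_seq_minus'; first exact: is_lim_seq_const.
  exact: Series_correct.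
have := is_lim_seq_le (fun _ => Rabs (E x)) _ (Rabs (E x)) _ key (is_lim_seq_const _) lim.
rewrite /=; lra.
Qed.

End Sieve.

(** * The values of zeta and its derivative at 2 *)

Lemma sum1_cat (f : nat -> R) N M : sum1 f (N + M) = sum1 f N + sum1 (fun k => f (N + k)%N) M.
Proof.
elim: M => [|M IH]; first by rewrite addn0 sum1_0 Rplus_0_r.
by rewrite addnS !sum1_S IH addnS Rplus_assoc.
Qed.

Lemma sum1_rev (f : nat -> R) N : sum1 f N = sum1 (fun k => f (N.+1 - k)%N) N.
Proof.
elim: N => [|N IH]; first by rewrite !sum1_0.
rewrite sum1_S IH -[in RHS](add1n N) sum1_cat sum1_S sum1_0 Rplus_0_l Rplus_comm.
by rewrite add1n subn1.
Qed.

Lemma sum1_fold (f : nat -> R) N :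
  sum1 f (N + N) = sum1 (fun k => f k + f ((N + N).+1 - k)%N) N.
Proof.
rewrite sum1_cat (sum1_rev (fun k => f (N + k)%N)) -sum1_plus.
by apply: sum1_ext => k /andP [k0 kN]; congr (_ + f _); lia.
Qed.

Lemma x_cos_le_sin t : 0 <= t <= PI -> t * cos t <= sin t.
Proof.
move=> [[t0|<-] tPI]; last by rewrite sin_0; lra.
have [|c [cE [c0 ct]]] := @MVT_cor2 (fun u => sin u - u * cos u) (fun u => u * sin u) 0 t t0.
  by move=> u _; apply/is_derive_Reals; auto_derive => //; ring.
rewrite sin_0 in cE.
have sc : 0 <= sin c by apply: sin_ge_0; lra.
have : 0 <= c * sin c * (t - 0) by apply: Rmult_le_pos; [nra | lra].
lra.
Qed.

Lemma inv_sqr_sin_bounds t : 0 < t < PI / 2 -> / sin t ^ 2 - 1 <= / t ^ 2 <= / sin t ^ 2.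
Proof.
move=> [t0 tP].
have s0 : 0 < sin t by apply: sin_gt_0; lra.
have c0 : 0 < cos t by apply: cos_gt_0; lra.
have st := sin_lt_x _ t0.
have tc := @x_cos_le_sin t ltac:(lra).
have sc : sin t ^ 2 + cos t ^ 2 = 1 by have := sin2_cos2 t; rewrite /Rsqr; lra.
split; last by apply: Rinv_le_contravar; [nra | apply: pow_incr; lra].
have -> : / sin t ^ 2 - 1 = cos t ^ 2 * / sin t ^ 2.
  by rewrite (_ : cos t ^ 2 = 1 - sin t ^ 2); [field; lra | lra].
apply: (Rmult_le_reg_r (t ^ 2 * sin t ^ 2)); first by apply: Rmult_lt_0_compat; apply: pow_lt.
rewrite (_ : cos t ^ 2 * / sin t ^ 2 * _ = (t * cos t) ^ 2); last by field; lra.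
rewrite (_ : / t ^ 2 * _ = sin t ^ 2); last by field; lra.
apply: pow_incr; nra.
Qed.

Definition odd_angle N k := (2 * INR k - 1) * PI / (4 * INR N).

Lemma odd_angle_bounds N k : (0 < k <= N)%N -> 0 < odd_angle N k < PI / 2.
Proof.
move=> /andP [k0 kN]; have k1 := INR_ge1 k0; have kN' : INR k <= INR N by apply: le_INR; lia.
have P0 := PI_RGT_0; rewrite /odd_angle; split.
  by apply: Rdiv_lt_0_compat; nra.
apply/(Rlt_div_l _ _ (4 * INR N)); nra.
Qed.

(* The sum of csc^2 over the odd multiples of pi / (4 N) below pi / 2; it
   quadruples with N because csc^2 t + csc^2 (pi / 2 - t) = 4 csc^2 (2 t), and
   / t ^ 2 differs from csc^2 t by at most 1. *)
Definition cosecant_sum N := sum1 (fun k => / sin (odd_angle N k) ^ 2) N.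

Lemma cosecant_sum_double N : (0 < N)%N -> cosecant_sum (N + N) = 4 * cosecant_sum N.
Proof.
move=> N0; rewrite /cosecant_sum sum1_fold -sum1_scal; apply: sum1_ext => k kN.
have n0 := INR_gt0 N0.
set t := odd_angle (N + N) k.
have -> : odd_angle N k = 2 * t by rewrite /t /odd_angle plus_INR; field; lra.
have -> : odd_angle (N + N) ((N + N).+1 - k) = PI / 2 - t.
  rewrite /t /odd_angle minus_INR; last lia.
  rewrite S_INR plus_INR; field; lra.
have [t0 tP] : 0 < 2 * t < PI / 2.
  have -> : 2 * t = odd_angle N k by rewrite /t /odd_angle plus_INR; field; lra.
  exact: odd_angle_bounds.
rewrite sin_shift sin_2a.
have s0 : 0 < sin t by apply: sin_gt_0; lra.
have c0 : 0 < cos t by apply: cos_gt_0; lra.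
have sc : sin t ^ 2 + cos t ^ 2 = 1 by have := sin2_cos2 t; rewrite /Rsqr; lra.
transitivity ((sin t ^ 2 + cos t ^ 2) * / (sin t ^ 2 * cos t ^ 2)); first by field; lra.
by rewrite sc; field; lra.
Qed.

Lemma cosecant_sum_pow2 n : cosecant_sum (2 ^ n) = 2 * (2 ^ n) ^ 2.
Proof.
elim: n => [|n IH].
  rewrite /cosecant_sum expn0 sum1_S sum1_0 /odd_angle.
  rewrite (_ : (2 * INR 1 - 1) * PI / (4 * INR 1) = PI / 4); last by rewrite /=; field.
  rewrite sin_PI4 (_ : (1 / sqrt 2) ^ 2 = / 2); first by rewrite /=; field.
  have q := sqrt_sqrt 2 ltac:(lra); have q0 : 0 < sqrt 2 by apply: sqrt_lt_R0; lra.
  by rewrite -[in RHS]q; field; lra.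
rewrite expnS mul2n -addnn cosecant_sum_double ?expn_gt0 // IH /=; ring.
Qed.

Definition odd_square_sum N := sum1 (fun k => / (2 * INR k - 1) ^ 2) N.

Lemma odd_square_sum_bounds n :
  PI ^ 2 / 16 * (2 - (/ 2) ^ n) <= odd_square_sum (2 ^ n) <= PI ^ 2 / 8.
Proof.
set N := (2 ^ n)%N; have N0 : (0 < N)%N by rewrite expn_gt0.
have n0 := INR_gt0 N0; have P0 := PI_RGT_0.
have NE : INR N = 2 ^ n by rewrite /N INR_expn.
have scale : odd_square_sum N = PI ^ 2 / (16 * INR N ^ 2) * sum1 (fun k => / odd_angle N k ^ 2) N.
  rewrite -sum1_scal; apply: sum1_ext => k /andP [k0 _]; have k1 := INR_ge1 k0.
  rewrite /odd_angle; field; lra.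
have b k : (0 < k <= N)%N -> _ := fun h => inv_sqr_sin_bounds (odd_angle_bounds h).
have hi : sum1 (fun k => / odd_angle N k ^ 2) N <= cosecant_sum N.
  by apply: sum1_le => k /b [].
have lo : cosecant_sum N - INR N <= sum1 (fun k => / odd_angle N k ^ 2) N.
  have -> : cosecant_sum N - INR N = sum1 (fun k => / sin (odd_angle N k) ^ 2 - 1) N.
    rewrite sum1_minus; congr (_ - _).
    rewrite sum_n_m_const (_ : (N.+1 - 1)%coq_nat = N); [by rewrite Rmult_1_r | lia].
  by apply: sum1_le => k /b [].
rewrite cosecant_sum_pow2 -NE in lo hi.
have c0 : 0 < PI ^ 2 / (16 * INR N ^ 2) by apply: Rdiv_lt_0_compat; nra.
rewrite scale pow_inv -NE; split.
  apply: Rle_trans (Rmult_le_compat_l _ _ _ (Rlt_le _ _ c0) lo).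
  by apply: Req_le; field; lra.
apply: Rle_trans (Rmult_le_compat_l _ _ _ (Rlt_le _ _ c0) hi) _.
by apply: Req_le; field; lra.
Qed.

Lemma inverse_square_sum_double N :
  sum1 (fun k => / INR k ^ 2) (N + N) = / 4 * sum1 (fun k => / INR k ^ 2) N + odd_square_sum N.
Proof.
rewrite /odd_square_sum; elim: N => [|N IH]; first by rewrite !sum1_0; lra.
rewrite addSn addnS !sum1_S IH; have n0 := pos_INR N.
rewrite !S_INR plus_INR; field; lra.
Qed.

Lemma Basel : Series (fun n => / INR n.+1 ^ 2) = PI ^ 2 / 6.
Proof.
have := Series_correct _ ex_series_inv_sqr; set z := Series _.
move/(is_series_sum1 (fun n => / INR n ^ 2)) => hz.
have sub (phi : nat -> nat) : (forall n, (phi n < phi n.+1)%coq_nat) ->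
    is_lim_seq (fun n => sum1 (fun k => / INR k ^ 2) (phi n)) z.
  move=> phi_incr; apply: (is_lim_seq_subseq (sum_n_m (fun k => / INR k ^ 2) 1) _ phi) => //.
  exact: eventually_subseq.
have l1 : is_lim_seq (fun n => sum1 (fun k => / INR k ^ 2) (2 ^ n)%N) z.
  by apply: sub => n; apply/ltP; rewrite ltn_exp2l.
have l2 : is_lim_seq (fun n => sum1 (fun k => / INR k ^ 2) (2 ^ n + 2 ^ n)%N) z.
  by apply: sub => n; apply/ltP; rewrite !addnn ltn_double ltn_exp2l.
have l3 : is_lim_seq (fun n => odd_square_sum (2 ^ n)) (PI ^ 2 / 8).
  apply: (is_lim_seq_le_le _ _ _ _ odd_square_sum_bounds); last exact: is_lim_seq_const.
  rewrite (_ : PI ^ 2 / 8 = PI ^ 2 / 16 * (2 - 0)); last field.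
  apply: is_lim_seq_mult'; first exact: is_lim_seq_const.
  apply: is_lim_seq_minus'; first exact: is_lim_seq_const.
  by apply: is_lim_seq_geom; rewrite Rabs_pos_eq; lra.
have l4 : is_lim_seq (fun n => sum1 (fun k => / INR k ^ 2) (2 ^ n + 2 ^ n)%N)
    (/ 4 * z + PI ^ 2 / 8).
  apply: (is_lim_seq_ext (fun n =>
      / 4 * sum1 (fun k => / INR k ^ 2) (2 ^ n)%N + odd_square_sum (2 ^ n))).
    by move=> n; rewrite inverse_square_sum_double.
  apply: is_lim_seq_plus' => //; apply: is_lim_seq_mult' => //; exact: is_lim_seq_const.
have := is_lim_seq_unique _ _ l4; rewrite (is_lim_seq_unique _ _ l2) => - [e].
lra.
Qed.

Lemma exp_taylor2 u : Rabs (exp u - 1 - u) <= u ^ 2 * exp (Rabs u).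
Proof.
have h1 := exp_ineq1_le u; have h2 := exp_ineq1_le (- u).
have e0 := exp_pos u; rewrite exp_Ropp in h2.
have ei : exp u * / exp u = 1 by apply: Rinv_r; lra.
have h3 : exp u - 1 <= u * exp u by nra.
rewrite Rabs_pos_eq; last lra.
case: (Rle_lt_dec 0 u) => u0; first by rewrite Rabs_pos_eq //; nra.
have : 1 <= exp (Rabs u) by have := exp_ineq1_le (Rabs u); have := Rabs_pos u; lra.
nra.
Qed.

Lemma is_derive_quadratic (f : R -> R) a l K d : 0 < d ->
  (forall h, Rabs h <= d -> Rabs (f (a + h) - f a - h * l) <= K * h ^ 2) ->
  is_derive f a l.
Proof.
move=> d0 H; apply/is_derive_Reals => eps eps0.
have K0 := Rabs_pos K.
have D0 : 0 < Rmin d (eps / (Rabs K + 1)).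
  by apply: Rmin_glb_lt => //; apply: Rdiv_lt_0_compat; lra.
exists (mkposreal _ D0) => h h0 /= hD.
have hd : Rabs h <= d by have := Rmin_l d (eps / (Rabs K + 1)); lra.
have he : Rabs h < eps / (Rabs K + 1) by have := Rmin_r d (eps / (Rabs K + 1)); lra.
have h1 : 0 < Rabs h by exact: Rabs_pos_lt.
move/(Rlt_div_r _ _ (Rabs K + 1)): he => /(_ ltac:(lra)) he.
rewrite (_ : (f (a + h) - f a) / h - l = (f (a + h) - f a - h * l) / h); last by field.
rewrite Rabs_div //; apply/(Rlt_div_l _ _ (Rabs h)) => //.
apply: Rle_lt_trans (H _ hd) _.
rewrite -(pow2_abs h).
have : K <= Rabs K by exact: Rle_abs.
nra.
Qed.

Lemma ex_series_zeta s : 1 < s -> ex_series (fun n => / Rpower (INR n.+1) s).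
Proof. by move=> /ex_series_Rpower; apply: ex_series_ext => n; rewrite Rpower_Ropp. Qed.

Lemma ln_sqr_le y : 1 <= y -> ln y ^ 2 <= 64 * Rpower y (1 / 4).
Proof.
move=> y1; have l0 : 0 <= ln y by rewrite -ln_1; apply: ln_le; lra.
have := @ln_le_Rpower (1 / 8) y ltac:(lra) ltac:(lra).
have -> : Rpower y (1 / 4) = Rpower y (1 / 8) * Rpower y (1 / 8).
  by rewrite -Rpower_plus; congr Rpower; field.
have : 0 < Rpower y (1 / 8) by exact: exp_pos.
set t := Rpower y (1 / 8); move=> t0 h.
have : ln y <= 8 * t by lra.
nra.
Qed.

Lemma zeta_term_taylor n h : Rabs h <= 1 / 4 ->
  Rabs (/ Rpower (INR n.+1) (2 + h) - / Rpower (INR n.+1) 2 + h * (ln (INR n.+1) / INR n.+1 ^ 2))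
  <= h ^ 2 * (64 * Rpower (INR n.+1) (- (3 / 2))).
Proof.
move=> h4; set y := INR n.+1; have y1 : 1 <= y by exact: INR_ge1.
have l0 : 0 <= ln y by rewrite -ln_1; apply: ln_le; lra.
rewrite -!Rpower_Ropp.
have -> : Rpower y (- (2 + h)) = Rpower y (- (2)) * exp (- h * ln y).
  by rewrite /Rpower -exp_plus; congr exp; ring.
rewrite /Rdiv -Rpower_neg2 -/y.
have p0 : 0 < Rpower y (- (2)) by exact: exp_pos.
rewrite (_ : _ + _ = Rpower y (- (2)) * (exp (- h * ln y) - 1 - (- h * ln y))); last ring.
rewrite Rabs_mult (Rabs_pos_eq (Rpower _ _)); last lra.
have ue : exp (Rabs (- h * ln y)) <= Rpower y (1 / 4).
  rewrite Rabs_mult Rabs_Ropp (Rabs_pos_eq (ln y)) //.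
  have : Rabs h * ln y <= 1 / 4 * ln y by apply: Rmult_le_compat_r.
  by rewrite /Rpower; case=> [/exp_increasing/Rlt_le //|->]; exact: Rle_refl.
have T := exp_taylor2 (- h * ln y).
have -> : Rpower y (- (3 / 2)) = Rpower y (- (2)) * (Rpower y (1 / 4) * Rpower y (1 / 4)).
  by rewrite -!Rpower_plus; congr Rpower; field.
rewrite (_ : h ^ 2 * _ = Rpower y (- (2)) *
  (h ^ 2 * (64 * Rpower y (1 / 4)) * Rpower y (1 / 4))); last ring.
apply: Rmult_le_compat_l; first lra.
apply: Rle_trans T _.
have q0 : 0 < Rpower y (1 / 4) by exact: exp_pos.
have h2 : 0 <= h ^ 2 by exact: pow2_ge_0.
apply: Rmult_le_compat => //; first exact: pow2_ge_0.
  by apply: Rlt_le; exact: exp_pos.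
rewrite (_ : (- h * ln y) ^ 2 = h ^ 2 * ln y ^ 2); last ring.
by apply: Rmult_le_compat_l => //; exact: ln_sqr_le.
Qed.

Lemma ex_series_ln_div_sqr : ex_series (fun n => ln (INR n.+1) / INR n.+1 ^ 2).
Proof.
apply: (ex_series_le _ (fun n => 2 * Rpower (INR n.+1) (- (3 / 2)))); last first.
  by apply: (ex_series_scal_l 2); apply: ex_series_Rpower; lra.
move=> n; have y1 : 1 <= INR n.+1 by exact: INR_ge1.
have l0 : 0 <= ln (INR n.+1) by rewrite -ln_1; apply: ln_le; lra.
have p0 : 0 < Rpower (INR n.+1) (- (2)) by exact: exp_pos.
rewrite /norm /= /abs /= -/(INR n.+1) -/(pow _ 2).
rewrite /Rdiv -Rpower_neg2 Rabs_pos_eq; last by apply: Rmult_le_pos; lra.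
have -> : Rpower (INR n.+1) (- (3 / 2)) = Rpower (INR n.+1) (1 / 2) * Rpower (INR n.+1) (- (2)).
  by rewrite -!Rpower_plus; congr Rpower; field.
rewrite -Rmult_assoc; apply: Rmult_le_compat_r; first lra.
have := @ln_le_Rpower (1 / 2) (INR n.+1) ltac:(lra) ltac:(lra); lra.
Qed.

Lemma Derive_zeta_2 : Derive zeta 2 = - Series (fun n => ln (INR n.+1) / INR n.+1 ^ 2).
Proof.
apply: is_derive_unique.
apply: (@is_derive_quadratic _ _ _ (Series (fun n => 64 * Rpower (INR n.+1) (- (3 / 2)))) (1 / 4)).
  lra.
move=> h h4; have hb := Rabs_le_between h (1 / 4); move/hb in h4.
have exK : ex_series (fun n => h ^ 2 * (64 * Rpower (INR n.+1) (- (3 / 2)))).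
  apply: (ex_series_scal_l (h ^ 2)); apply: (ex_series_scal_l 64).
  by apply: ex_series_Rpower; lra.
have ex2 : ex_series (fun n => / Rpower (INR n.+1) 2) by apply: ex_series_zeta; lra.
have exh : ex_series (fun n => / Rpower (INR n.+1) (2 + h)) by apply: ex_series_zeta; lra.
have exl : ex_series (fun n => h * (ln (INR n.+1) / INR n.+1 ^ 2)).
  by apply: (ex_series_scal_l h); exact: ex_series_ln_div_sqr.
have T n := zeta_term_taylor n (proj2 hb h4).
have exm : ex_series (fun n => / Rpower (INR n.+1) (2 + h) - / Rpower (INR n.+1) 2).
  exact: (ex_series_minus _ _ exh ex2).
rewrite /zeta -Series_minus // Ropp_mult_distr_r_reverse /Rminus Ropp_involutive.
rewrite -Series_scal_l -Series_plus // Rmult_comm -Series_scal_l.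
have exa : ex_series (fun n => Rabs (/ Rpower (INR n.+1) (2 + h) - / Rpower (INR n.+1) 2
             + h * (ln (INR n.+1) / INR n.+1 ^ 2))).
  apply: (ex_series_le _ _ _ exK) => n; rewrite /norm /= /abs /= Rabs_Rabsolu; exact: T.
apply: Rle_trans (Series_Rabs _ exa) _.
by apply: Series_le => // n; split; [exact: Rabs_pos | exact: T].
Qed.

Lemma zeta_2 : zeta 2 = PI ^ 2 / 6.
Proof.
rewrite -Basel; apply: Series_ext => n.
by rewrite -Rpower_neg2 Rpower_Ropp.
Qed.

Definition main_term (y : R) : R := 3 / PI ^ 2 * y * ln y + c_const * y.

Lemma is_series_main_term x : 0 < x ->
  is_series (fun n => main_term (x / INR n.+1 ^ 2)) (x * (ln x / 2 + (3 * euler_gamma - 1) / 2)).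
Proof.
move=> x0; have P0 := PI_RGT_0.
set L := Series (fun n => ln (INR n.+1) / INR n.+1 ^ 2).
have s2 := Series_correct _ ex_series_inv_sqr; rewrite Basel in s2.
have sL := Series_correct _ ex_series_ln_div_sqr; rewrite -/L in sL.
have s := is_series_minus _ _ _ _
  (is_series_scal_l (x * (3 / PI ^ 2 * ln x + c_const)) _ _ s2)
  (is_series_scal_l (6 / PI ^ 2 * x) _ _ sL).
have -> : x * (ln x / 2 + (3 * euler_gamma - 1) / 2)
  = x * (3 / PI ^ 2 * ln x + c_const) * (PI ^ 2 / 6) - 6 / PI ^ 2 * x * L.
  rewrite /c_const Derive_zeta_2 -/L zeta_2; field; lra.
apply: is_series_ext s => n; have n0 := @INR_gt0 n.+1 isT.
have n2 : 0 < INR n.+1 ^ 2 by exact: pow_lt.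
rewrite /main_term ln_div // ln_pow // (_ : INR 2 = 2) //.
rewrite /minus /plus /opp /scal /mult; cbn -[INR ln PI pow IZR c_const].
field; lra.
Qed.

Theorem proposition28 :
  exists (K x0 : R), forall x : R, x0 <= x ->
    Rabs (sum_pos_le (fun r => INR (N1_zero r)) x
          - (3 / PI ^ 2 * x * ln x + c_const * x))
    <= K * Rpower x (2 / 3).
Proof.
have [C [C0 HC]] := square_quotient_sum_asymptotic.
exists (C * exp (1 + / (2 * (2 / 3) - 1))), 1 => x x1.
apply: (@sieve_bound (fun y => N1_zero_sum y - main_term y)) => //; try lra.
- move=> X X0; have [K [K0 HK]] := N1_zero_sum_growth X0.
  have [M [M0 HM]] := @xlnx_main_growth (3 / PI ^ 2) c_const X X0.
  exists (K + M); split=> [|y yX]; first lra.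
  apply: Rle_trans (Rabs_triang _ _) _; rewrite Rabs_Ropp Rmult_plus_distr_r.
  apply: Rplus_le_compat; first exact: HK.
  have := HM y yX; rewrite /main_term.
  by rewrite (_ : y * _ = 3 / PI ^ 2 * y * ln y + c_const * y); last ring.
- move=> y y0.
  have s := is_series_minus _ _ _ _ (is_series_N1_zero_sum y0) (is_series_main_term y0).
  by rewrite (is_series_unique _ _ s); exact: HC.
Qed.
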